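(* As $n\to\infty$, \[ \tilde r(3,n)=\Omega\left(\frac{n^3}{\log^2 n}\right). \]
   Context: The $(m,n)$-online Ramsey game is played by two players, Builder and Painter, on an infinite set of initially isolated vertices. Each turn, Builder places an edge between two nonadjacent vertices and Painter immediately paints it red or blue. The online Ramsey number $\tilde r(m,n)$ is the smallest number of turns within which Builder can guarantee the existence of either a red $K_m$ or a blue $K_n$, whatever Painter does. Logarithms are natural; the implicit constant in $\Omega$ is a positive absolute constant. *)

(* Defs.v *)
From HB Require Import structures.
From mathcomp Require Import all_boot.
From mathcomp Require Import boolp.

Set Implicit Arguments.
Unset Strict Implicit.
Unset Printing Implicit Defensive.

Definition color := bool.
Definition red : color := true.
Definition blue : color := false.

Definition vertex := nat.

(* The history of a game, most recent turn first: each entry is the edge placed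
   by Builder, given by its two endpoints in either order, and the color that
   Painter gave it. *)
Definition history := seq (vertex * vertex * color).

Definition colored_edge (c : color) (h : history) (u v : vertex) : bool :=
  ((u, v, c) \in h) || ((v, u, c) \in h).

Definition adjacent (h : history) (u v : vertex) : bool :=
  colored_edge red h u v || colored_edge blue h u v.

Definition legal (h : history) (e : vertex * vertex) : bool :=
  (e.1 != e.2) && ~~ adjacent h e.1 e.2.

Definition has_clique (c : color) (k : nat) (h : history) : Prop :=
  exists s : seq vertex,
    [/\ uniq s, size s = k &
        {in s &, forall u v, u != v -> colored_edge c h u v}].

Definition builder := history -> vertex * vertex.
Definition painter := history -> vertex * vertex -> color.

Fixpoint play (B : builder) (P : painter) (t : nat) : history :=
  if t is t'.+1 then
    let h := play B P t' in (B h, P h (B h)) :: h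
  else [::].

(* A monochromatic clique persists once created, so having one within N turns
   is the same as having one after exactly N turns.  A legal move exists at
   every history, because there are infinitely many vertices; hence requiring
   legality at all histories, reachable or not, does not restrict Builder. *)
Definition builder_wins (m n N : nat) : Prop :=
  exists B : builder,
    (forall h, legal h (B h)) /\
    (forall P : painter,
       has_clique red m (play B P N) \/ has_clique blue n (play B P N)).

Lemma ramsey (m n : nat) : exists M : nat, forall (h : history) (s : seq vertex),
  uniq s -> M <= size s ->
  {in s &, forall u v, u != v -> adjacent h u v} ->
  has_clique red m h \/ has_clique blue n h.
Proof.
suff: exists M : nat, forall (h : history) (s : seq vertex),
  uniq s -> M <= size s ->
  {in s &, forall u v, u != v -> adjacent h u v} ->
  exists c, exists2 t, [/\ uniq t, size t = (if c then m else n) & {subset t <= s}]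
     & {in t &, forall u v, u != v -> colored_edge c h u v}.
  case=> M HM; exists M => h s us Ms adj.
  by have [[] [t [ut st _] Ht]] := HM h s us Ms adj; [left|right]; exists t.
elim: m n => [|m IHm] n.
  by exists 0 => h s _ _ _; exists true, [::].
elim: n => [|n [b IHn]].
  by exists 0 => h s _ _ _; exists false, [::].
have [a Ha] := IHm n.+1.
exists (a + b).+1 => h [//|x s] /= /andP[xs us] sz adj.
have ok (t : seq vertex) : {subset t <= s} -> {in t &, forall u v, u != v -> adjacent h u v}.
  by move=> ts u v /ts us' /ts vs'; apply: adj; rewrite inE ?us' ?vs' orbT.
pose r := [seq y <- s | colored_edge red h x y].
pose l := [seq y <- s | ~~ colored_edge red h x y].
have szrl : size r + size l = size s by rewrite !size_filter count_predC.
have csym c u v : colored_edge c h u v = colored_edge c h v u.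
  by rewrite /colored_edge orbC.
have rs : {subset r <= s} by move=> y; rewrite mem_filter => /andP[].
have ls : {subset l <= s} by move=> y; rewrite mem_filter => /andP[].
have rx y : y \in r -> colored_edge red h x y by rewrite mem_filter => /andP[].
have lx y : y \in l -> colored_edge blue h x y.
  rewrite mem_filter => /andP[nr ys].
  have : adjacent h x y.
    apply: adj; rewrite ?inE ?eqxx ?ys ?orbT //.
    by apply: contraNneq xs => ->.
  by rewrite /adjacent (negPf nr).
have ext c (t : seq vertex) : {subset t <= s} -> uniq t ->
    (forall y, y \in t -> colored_edge c h x y) ->
    {in t &, forall u v, u != v -> colored_edge c h u v} ->
    [/\ uniq (x :: t), {subset x :: t <= x :: s} &
     {in x :: t &, forall u v, u != v -> colored_edge c h u v}].
  move=> ts ut xt Ht; split.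
  - by rewrite /= ut andbT; apply: contra xs => /ts.
  - by move=> y; rewrite !inE => /orP[->//|/ts ->]; rewrite orbT.
  - move=> u v; rewrite !inE => /orP[/eqP->|ut'] /orP[/eqP->|vt'].
    + by rewrite eqxx.
    + by move=> _; apply: xt.
    + by move=> _; rewrite csym; apply: xt.
    + exact: Ht.
have sub (t q : seq vertex) : {subset t <= q} -> {subset q <= s} -> {subset t <= x :: s}.
  by move=> tq qs y /tq /qs ys; rewrite inE ys orbT.
have [ar|ra] := leqP a (size r).
  have [[] [t [ut st tr] Ht]] := Ha h r (filter_uniq _ us) ar (ok _ rs).
    have [||u1 u2 u3] := ext red t _ ut _ Ht.
    - by move=> y /tr /rs.
    - by move=> y /tr /rx.
    by exists true, (x :: t) => //; split=> //=; rewrite st.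
  by exists false, t => //; split=> //; apply: sub rs.
have bl : b <= size l.
  rewrite -(leq_add2l a); rewrite ltnS in sz; apply: (leq_trans sz).
  by rewrite -szrl leq_add2r ltnW.
have [[] [t [ut st tl] Ht]] := IHn h l (filter_uniq _ us) bl (ok _ ls).
  by exists true, t => //; split=> //; apply: sub ls.
have [||u1 u2 u3] := ext blue t _ ut _ Ht.
- by move=> y /tl /ls.
- by move=> y /tl /lx.
by exists false, (x :: t) => //; split=> //=; rewrite st.
Qed.

Lemma builder_wins_ex (m n : nat) : exists N : nat, `[< builder_wins m n N >].
Proof.
have [M HM] := ramsey m n.
pose L := [seq e <- [seq (i, j) | i <- iota 0 M, j <- iota 0 M] | e.1 != e.2].
pose top (h : history) := \max_(x <- h) maxn x.1.1 x.1.2.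
pose B (h : history) :=
  if has (legal h) L then nth (0, 0) L (find (legal h) L)
  else ((top h).+1, (top h).+2).
have topP h x : x \in h -> (x.1.1 <= top h) && (x.1.2 <= top h).
  by move=> xh; rewrite -geq_max /top (big_rem x xh) leq_maxl.
have legB h : legal h (B h).
  rewrite /B; case: ifP => [|_]; first exact: nth_find.
  rewrite /legal /= neq_ltn ltnSn /= /adjacent /colored_edge !negb_or.
  by apply/andP; split; apply/andP; split; apply/negP => /topP /=;
     rewrite ?ltnn ?andbF // ltnNge leqnSn.
exists (size L); apply/asboolP; exists B; split=> // P.
have mono h x : subpred (legal (x :: h)) (legal h).
  move=> e /andP[e12]; rewrite /legal e12 /=; apply: contra.
  rewrite /adjacent /colored_edge !inE.
  by case/orP=> /orP[] ->; rewrite ?orbT.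
have cnt t : count (legal (play B P t)) L <= size L - t.
  elim: t => [|t IH]; first by rewrite subn0 count_size.
  rewrite subnS /=; set h := play B P t in IH *; set x := (B h, _).
  have [lt|] := boolP (has (legal h) L); last first.
    rewrite has_count -eqn0Ngt => /eqP c0.
    by have := sub_count (mono h x) L; rewrite c0 leqn0 => /eqP ->.
  have BL : B h \in L by rewrite /B lt mem_nth // -has_find.
  suff lt' : count (legal (x :: h)) L < count (legal h) L.
    by have := leq_trans lt' IH; case: (size L - t).
  have nB : ~~ legal (x :: h) (B h).
    rewrite /legal negb_and negbK orbC /adjacent /colored_edge /x !inE.
    by case: (B h) (P h (B h)) => [u v] []; rewrite !eqxx ?orbT.
  have -> : count (legal h) L =
      count (predI (legal h) (legal (x :: h))) L
      + count (predI (legal h) (predC (legal (x :: h)))) L.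
    rewrite -count_predUI [X in _ + X](_ : _ = 0) ?addn0; last first.
      by apply/eqP; rewrite -[_ == 0]negbK -lt0n -has_count; apply/hasP => -[e _] /=;
         case: (legal (x :: h) e); rewrite ?andbF.
    by apply: eq_count => e /=; case: (legal h e); case: (legal (x :: h) e).
  rewrite -addn1 leq_add //.
    by apply: sub_count => e /= le; rewrite le (mono _ _ _ le).
  by rewrite -has_count; apply/hasP; exists (B h) => //=; rewrite legB nB.
apply: (HM _ (iota 0 M)); rewrite ?iota_uniq ?size_iota // => u v uM vM uv.
have: count (legal (play B P (size L))) L <= 0 by rewrite -(subnn (size L)).
rewrite leqn0 -[_ == 0]negbK -lt0n -has_count => /hasPn /(_ (u, v)).
rewrite mem_filter /= uv allpairs_f //= => /(_ isT).
by rewrite /legal /= uv negbK.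
Qed.

Definition online_ramsey (m n : nat) : nat := ex_minn (builder_wins_ex m n).

(* Main.v *)
(** Painter paints blue every edge having an endpoint of current degree below
    d = n/4; an edge between two vertices of degree at least d is "live".  Within
    N turns at most 2N/d vertices become active, and numbering them in order of
    activation turns the live edges into a game on a fixed vertex set V of size
    about n^2/log^2 n.  A random Painter would paint a live edge red with
    probability p ~ log n/n unless this closes a red triangle, as in Erdos's
    lower bound for r(3,n); conditional expectations make this Painter
    deterministic.  The potential bounds the probability of three bad events: a
    vertex of large red degree, two n-sets W and S with more than about
    n log n red pairs in W x S, and an n-set S without red edges in which at
    least n^2/16 edges were played that closed no red triangle.  If the first
    two fail, then the sum over w of the squared number of red neighbors of w
    in S is a small multiple of n^2, and this sum bounds the number of edges in S
    that were blocked by a red triangle.  A blue K_n, however, has at least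
    about n^2/4 live edges. *)
Require Import Defs.
From HB Require Import structures.
From mathcomp Require Import all_boot all_order all_algebra.
From mathcomp Require Import zify ring lra.
Import Order.TTheory GRing.Theory Num.Theory.
Set Implicit Arguments.
Unset Strict Implicit.
Unset Printing Implicit Defensive.
Local Open Scope ring_scope.

(** * The game on a fixed finite vertex set *)

Section AbstractGame.
Variable V : finType.
Implicit Types (g : seq (V * V * color)) (u v w : V) (S W : {set V}) (X : {set V * V}).

Definition joined c g u v := ((u, v, c) \in g) || ((v, u, c) \in g).

Definition played g u v := joined red g u v || joined blue g u v.

Definition blocked g u v := [exists w, joined red g w u && joined red g w v].

Fixpoint valid (Q : seq (V * V * color) -> V -> V -> color) g : bool :=
  if g is (u, v, c) :: g' then
    [&& u != v, ~~ played g' u v, c == Q g' u v & valid Q g']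
  else true.

Definition inside S (x : V * V * color) := (x.1.1 \in S) && (x.1.2 \in S).

(* Edges inside S that closed no red triangle at the time they were played. *)
Fixpoint free_count S g : nat :=
  if g is (u, v, c) :: g' then
    ((u \in S) && (v \in S) && ~~ blocked g' u v + free_count S g')%N
  else 0%N.

Definition red_nbr g w := [set v | joined red g w v].

Definition no_red S g :=
  forall u v, u \in S -> v \in S -> ~~ joined red g u v.

(** Blue cliques are excluded by counting: the ranks of a blue K_n would form an n-set without red
    edges that, for suitable parameters, contains at least [K] live edges. *)
Definition winning n K (Q : seq (V * V * color) -> V -> V -> color) :=
  forall g, valid Q g ->
    (forall u v w,
       ~~ [&& joined red g u v, joined red g v w & joined red g u w]) /\
    (forall S, #|S| = n -> no_red S g -> (count (inside S) g < K)%N).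

Lemma joinedC c g u v : joined c g u v = joined c g v u.
Proof. by rewrite /joined orbC. Qed.

Lemma joined_cons c c' g u v x y : joined c ((u, v, c') :: g) x y =
  (c == c') && (((x, y) == (u, v)) || ((x, y) == (v, u))) || joined c g x y.
Proof.
rewrite /joined !inE !xpair_eqE [(y == u) && (x == v)]andbC.
by case: (c == c'); case: (x == u); case: (y == v); case: (y == u);
   case: (x == v); rewrite ?orbT ?orbF //= ?orbT.
Qed.

(** An edge in [S] that was not free was blocked by some [w] with both ends in [red_nbr g w :&: S].
    No pair is played twice, so each [w] accounts for at most the square of the size of this set. *)
Lemma count_inside_le Q S g : valid Q g ->
  (count (inside S) g <= free_count S g + \sum_w #|red_nbr g w :&: S| ^ 2)%N.
Proof.
(* Blocking is tested in the final history; it persists, so an edge blocked when played is still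
   counted. *)
pose bl := fun g' (x : V * V * color) => inside S x && blocked g' x.1.1 x.1.2.
have bl_mono g' x : subpred (bl g') (bl (x :: g')).
  move=> y /andP[yS /existsP[w /andP[w1 w2]]]; rewrite /bl yS; apply/existsP; exists w.
  by case: x => -[a b] c; rewrite !joined_cons w1 w2 !orbT.
have bl_count : (count (inside S) g <= free_count S g + count (bl g) g)%N.
  elim: g => [//|[[u v] c] g' IH] /=.
  have := sub_count (bl_mono g' (u, v, c)) g'.
  have : (inside S (u, v, c) <=
     ((u \in S) && (v \in S) && ~~ blocked g' u v) + bl ((u, v, c) :: g') (u, v, c))%N.
    have := bl_mono g' (u, v, c) (u, v, c); rewrite {1}/bl /inside /=.
    by case: (u \in S); case: (v \in S); case: (blocked g' u v) => //= ->.
  lia.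
move=> vg; apply: leq_trans bl_count _; rewrite leq_add2l.
have ug : uniq [seq x.1 | x <- g].
  elim: g vg => [//|[[u v] c] g IH] /= /and4P[_ nuv _ /IH ->]; rewrite andbT.
  apply: contra nuv => /mapP[[[a b] c'] ug /= [-> ->]].
  by rewrite /played /joined; case: c' ug => ->; rewrite ?orbT.
rewrite -size_filter.
set s := filter _ _.
have us : uniq [seq x.1 | x <- s].
  exact: subseq_uniq (map_subseq _ (filter_subseq _ _)) ug.
rewrite -(size_map fst) -(card_uniqP us).
apply: (@leq_trans (\sum_(e in [seq x.1 | x <- s]) \sum_w
    ((e.1 \in red_nbr g w :&: S) && (e.2 \in red_nbr g w :&: S)))%N).
  rewrite -sum1_card; apply: leq_sum => e /mapP[x]; rewrite mem_filter.
  move=> /andP[/andP[/andP[xS1 xS2] /existsP[w /andP[w1 w2]]] _] ->.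
  by rewrite (bigD1 w) //= !inE w1 w2 xS1 xS2.
rewrite exchange_big /=; apply: leq_sum => w _.
set A := _ :&: S.
apply: (@leq_trans (\sum_(e in setX A A) 1)%N); last by rewrite sum1_card cardsX mulnn.
rewrite [X in (X <= _)%N](bigID (fun e => e \in setX A A)) /= [X in (_ + X)%N]big1 ?addn0.
  rewrite [X in (_ <= X)%N](bigID (fun e => e \in [seq x.1 | x <- s])) /=.
  apply: leq_trans (leq_addr _ _); rewrite leq_eqVlt; apply/orP; left; apply/eqP.
  apply: eq_big => [e|e]; first by rewrite andbC.
  by case: e => [a b]; rewrite in_setX => /andP[_ ->].
by move=> [a b] /andP[_]; rewrite in_setX => /negPf ->.
Qed.

Lemma subset_of_card (B : {set V}) (k : nat) : (k <= #|B|)%N ->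
  exists2 W : {set V}, W \subset B & #|W| = k.
Proof.
rewrite -bin_gt0 -cards_draws => /card_gt0P[W].
by rewrite inE => /andP[WB /eqP]; exists W.
Qed.

(** The sum is split at degree [t]: the squares of larger degrees are at most [D] times their sum,
    the others at most [t ^ 2] each. *)
Lemma sum_sqr_le g S (n D t : nat) : (n <= #|V|)%N ->
  (forall w, #|red_nbr g w :&: S| <= D)%N ->
  (forall W, #|W| = n -> \sum_(w in W) #|red_nbr g w :&: S| < n * t)%N ->
  (\sum_w #|red_nbr g w :&: S| ^ 2 <= D * (n * t) + #|V| * t ^ 2)%N.
Proof.
pose d w := #|red_nbr g w :&: S|; rewrite -/d => nV dD dt.
(* At most n vertices have at least t red neighbors in S, so all of them together
   have fewer than n * t. *)
pose B := [set w | t <= d w]%N.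
have BT W : (W \subset B -> #|W| * t <= \sum_(w in W) d w)%N.
  move=> /subsetP WB; rewrite -sum_nat_const; apply: leq_sum => w /WB.
  by rewrite inE.
have Bn : (#|B| <= n)%N.
  rewrite leqNgt; apply/negP => nB.
  have [W WB Wn] := subset_of_card (ltnW nB).
  by have := dt W Wn; rewrite -Wn ltnNge BT.
(* The hypothesis speaks only of sets of size exactly [n], so [B] is enlarged to one. *)
have [W BW Wn] : exists2 W : {set V}, B \subset W & #|W| = n.
  have [|C CB Cn] := @subset_of_card (~: B) (#|V| - n).
    by rewrite cardsCs setCK leq_sub2l.
  exists (~: C); first by rewrite -setCS setCK.
  by rewrite cardsCs setCK Cn subKn.
rewrite (bigID (mem B)) /=; apply: leq_add.
  apply: (@leq_trans (\sum_(w in W) D * d w)%N).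
    rewrite [X in (_ <= X)%N](bigID (mem B)) /=; apply: leq_trans (leq_addr _ _).
    rewrite [X in (_ <= X)%N](eq_bigl (mem B)); last first.
      by move=> w /=; case wB: (w \in B); rewrite ?andbF // (subsetP BW).
    by apply: leq_sum => w _; rewrite expnS expn1 leq_mul2r dD orbT.
  by rewrite -big_distrr leq_mul2l ltnW ?orbT // dt.
rewrite -sum_nat_const [X in (_ <= X)%N](bigID (mem B)) /=.
apply: leq_trans (leq_addl _ _); apply: leq_sum => w.
by rewrite inE -ltnNge => lt; rewrite leq_exp2r // ltnW.
Qed.

End AbstractGame.

(** * The derandomized Painter *)

Section Potential.
Variables (R : realFieldType) (V : finType) (p : R).
Implicit Types (g : seq (V * V * color)) (u v w : V) (S W : {set V}) (X : {set V * V}).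
Hypothesis (p_gt0 : 0 < p) (p_lt1 : p < 1).

Let p_ge0 : 0 <= p := ltW p_gt0.

Let subp_gt0 : 0 < 1 - p.
Proof. by rewrite subr_gt0. Qed.

(* A blocked edge is always painted blue; a free one is red with probability p. *)
Definition supermartingale (F : seq (V * V * color) -> R) :=
  forall g u v, u != v -> ~~ played g u v ->
    (blocked g u v -> F ((u, v, blue) :: g) <= F g) /\
    (~~ blocked g u v ->
       p * F ((u, v, red) :: g) + (1 - p) * F ((u, v, blue) :: g) <= F g).

Lemma supermartingale_sum (I : finType) (P : pred I) (a : R)
    (F : I -> seq (V * V * color) -> R) :
  0 <= a -> (forall i, P i -> supermartingale (F i)) ->
  supermartingale (fun g => \sum_(i | P i) a * F i g).
Proof.
move=> a0 HF g u v uv nuv; split=> [b|nb].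
  by apply: ler_sum => i /HF/(_ g u v uv nuv)[/(_ b) le _]; exact: ler_wpM2l.
rewrite !mulr_sumr -big_split; apply: ler_sum => i /HF/(_ g u v uv nuv)[_ /(_ nb) le].
by rewrite /= mulrCA [(1 - p) * _]mulrCA -mulrDr ler_wpM2l.
Qed.

Lemma supermartingaleD F G :
  supermartingale F -> supermartingale G ->
  supermartingale (fun g => F g + G g).
Proof.
move=> HF HG g u v uv nuv; have [F1 F2] := HF g u v uv nuv.
have [G1 G2] := HG g u v uv nuv; split=> [b|nb]; first by rewrite lerD ?F1 ?G1.
by have := F2 nb; have := G2 nb; lra.
Qed.

(* An edge {u, v} may occur in X both as (u, v) and as (v, u), so the weight
   1 + 3p of an unplayed pair has to dominate the mean 4p + (1 - p) of the
   squared weight of a played one. *)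
Definition pair_weight g (e : V * V) : R :=
  if joined red g e.1 e.2 then 2 else if played g e.1 e.2 then 1 else 1 + 3 * p.

Definition red_weight (X : {set V * V}) g := \prod_(e in X) pair_weight g e.

Lemma pair_weight_ge1 g e : 1 <= pair_weight g e.
Proof. by rewrite /pair_weight; have := p_ge0; case: ifP => _; [|case: ifP => _] => //; lra. Qed.

Lemma red_weight_ge0 X g : 0 <= red_weight X g.
Proof. by apply: prodr_ge0 => e _; apply: le_trans (pair_weight_ge1 g e). Qed.

Lemma red_weight_nil X : red_weight X [::] = (1 + 3 * p) ^+ #|X|.
Proof. by rewrite /red_weight prodr_const. Qed.

Lemma red_weight_lb X g :
  2 ^+ #|[set e in X | joined red g e.1 e.2]| <= red_weight X g.
Proof.
rewrite /red_weight (bigID (fun e => joined red g e.1 e.2)) /=.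
have -> : \prod_(e in X | joined red g e.1 e.2) pair_weight g e =
   2 ^+ #|[set e in X | joined red g e.1 e.2]|.
  rewrite -prodr_const; apply: eq_big => [e|e /andP[_ H]]; first by rewrite inE.
  by rewrite /pair_weight H.
rewrite -[leLHS]mulr1 ler_wpM2l ?exprn_ge0 //.
by elim/big_ind: _ => [//|x y x1 y1|e _]; [nra|exact: pair_weight_ge1].
Qed.

(** Only the factors at [(u, v)] and [(v, u)] change. With one of them in [X], the mean 2p + (1 - p)
    is at most 1 + 3p; with both, 4p + (1 - p) = 1 + 3p is at most its square. *)
Lemma red_weight_supermartingale X : supermartingale (red_weight X).
Proof.
move=> g u v uv nuv.
have split2 g' : red_weight X g' =
    (if (u, v) \in X then pair_weight g' (u, v) else 1) *
    ((if (v, u) \in X then pair_weight g' (v, u) else 1) *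
    \prod_(e in X | (e != (u, v)) && (e != (v, u))) pair_weight g' e).
  rewrite /red_weight (bigID (pred1 (u, v))) /= [X in _ * X](bigID (pred1 (v, u))) /=.
  congr (_ * _).
    case: ifP => [uX|uX].
      by rewrite (big_pred1 (u, v)) // => e /=; case: eqP => [->|]; rewrite ?uX ?andbF.
    by rewrite big_pred0 // => e; case: eqP => [->|]; rewrite ?uX ?andbF.
  congr (_ * _).
    case: ifP => [uX|uX].
      rewrite (big_pred1 (v, u)) // => e /=; case: (e =P (v, u)) => [->|]; rewrite ?uX ?andbF //=.
      by rewrite andbT xpair_eqE eq_sym (negPf uv).
    by rewrite big_pred0 // => e; case: (e =P (v, u)) => [->|]; rewrite ?uX ?andbF.
  by apply: eq_bigl => e; rewrite andbA.
set r := fun g' => \prod_(e in X | (e != (u, v)) && (e != (v, u))) pair_weight g' e.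
have rE c : r ((u, v, c) :: g) = r g.
  apply: eq_bigr => -[x y] /and3P[_ n1 n2].
  by rewrite /pair_weight /played !joined_cons (negPf n1) (negPf n2) !andbF.
have r0 : 0 <= r g by apply: prodr_ge0 => e _; apply: le_trans (pair_weight_ge1 g e).
have [nr nb] : joined red g u v = false /\ joined blue g u v = false.
  by move: nuv; rewrite negb_or => /andP[/negPf -> /negPf ->].
have w0 : pair_weight g (u, v) = 1 + 3 * p /\ pair_weight g (v, u) = 1 + 3 * p.
  by rewrite /pair_weight /played /= !(joinedC _ g v u) nr nb.
have w1 : pair_weight ((u, v, red) :: g) (u, v) = 2 /\
          pair_weight ((u, v, red) :: g) (v, u) = 2.
  by rewrite /pair_weight /played /= !joined_cons !eqxx ?orbT.
have w2 : pair_weight ((u, v, blue) :: g) (u, v) = 1 /\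
          pair_weight ((u, v, blue) :: g) (v, u) = 1.
  by rewrite /pair_weight /played /= !joined_cons !eqxx /= !(joinedC _ g v u) nr nb ?orbT.
rewrite !split2 -!/(r _) !rE; case: w0 w1 w2 => -> -> [-> ->] [-> ->].
have := p_ge0; have H1 : 0 <= p * r g by rewrite mulr_ge0 ?p_ge0.
have H2 : 0 <= p * (p * r g) by rewrite mulr_ge0 ?p_ge0.
by split=> _; case: ifP => _; case: ifP => _; lra.
Qed.

(** For the random Painter: the indicator that every edge played in [S] is blue, divided by the
    product of the conditional probabilities of this, so that its mean stays constant. *)
Fixpoint blue_weight S g : R :=
  if g is (u, v, c) :: g' then
    (if (u \in S) && (v \in S) then
       if c then 0 else if blocked g' u v then 1 else (1 - p)^-1
     else 1) * blue_weight S g'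
  else 1.

Lemma blue_weight_ge0 S g : 0 <= blue_weight S g.
Proof.
elim: g => [|[[u v] c] g IH] //=; apply: mulr_ge0 => //.
case: ifP => // _; case: ifP => // _; case: ifP => // _.
by rewrite invr_ge0 (ltW subp_gt0).
Qed.

Lemma blue_weightE S g : no_red S g ->
  blue_weight S g = (1 - p) ^- free_count S g.
Proof.
elim: g => [|[[u v] c] g IH] nrS /=; first by rewrite expr0 invr1.
rewrite IH; last first.
  by move=> x y xS yS; have := nrS _ _ xS yS; rewrite joined_cons negb_or => /andP[].
case: ifP => [/andP[uS vS]|_]; last by rewrite mul1r.
case: c nrS => nrS.
  by have := nrS _ _ uS vS; rewrite joined_cons !eqxx.
case: ifP => _ /=; rewrite ?mul1r ?add0n // add1n exprS invfM //.
Qed.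

Lemma blue_weight_supermartingale S : supermartingale (blue_weight S).
Proof.
move=> g u v uv nuv; have w0 := blue_weight_ge0 S g.
split=> [b|/negPf nb] /=; rewrite ?b ?nb; case: ifP => _; rewrite /= ?mul1r //; last by have := p_ge0; lra.
have p1 : 1 - p != 0 by rewrite gt_eqF // subp_gt0.
by rewrite mul0r mulr0 add0r mulrA divff ?mul1r.
Qed.

(** * The potential and the greedy Painter *)

Section Greedy.
Variables (n m D T : nat).

(** A summand reaches 1 once its bad event occurs: red degree at least [D], at least [T] red pairs
    in W x S, or at least [m] free edges in an [S] without red edges. *)
Definition potential g : R :=
  \sum_(w : V) 2 ^- D * red_weight (setX [set w] setT) g
  + \sum_(x : {set V} * {set V} | (#|x.1| == n) && (#|x.2| == n))
      2 ^- T * red_weight (setX x.1 x.2) g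
  + \sum_(S : {set V} | #|S| == n) (1 - p) ^+ m * blue_weight S g.

Hypothesis potential0 : potential [::] < 1.

Definition greedy g u v : color :=
  ~~ blocked g u v && (potential ((u, v, red) :: g) <= potential g).

Lemma potential_supermartingale : supermartingale potential.
Proof.
have h2 k : (0 : R) <= 2 ^- k by rewrite invr_ge0 exprn_ge0.
apply: supermartingaleD; first apply: supermartingaleD.
- by apply: supermartingale_sum => // w _; exact: red_weight_supermartingale.
- by apply: supermartingale_sum => // w _; exact: red_weight_supermartingale.
- apply: supermartingale_sum; first by rewrite exprn_ge0 // (ltW subp_gt0).
  by move=> S _; exact: blue_weight_supermartingale.
Qed.

(** If red would raise the potential at a free edge, blue cannot, because the mean with weights [p]
    and [1 - p] is at most the present value. *)
Lemma valid_potential g : valid greedy g -> potential g < 1.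
Proof.
elim: g => [//|[[u v] c] g IH] /= /and4P[uv nuv /eqP-> /IH]; apply: le_lt_trans.
have [H1 H2] := @potential_supermartingale g u v uv nuv.
rewrite /greedy; case: (boolP (blocked g u v)) => b /=; first exact: H1.
case: (leP (potential ((u, v, red) :: g)) (potential g)) => [//|lt].
rewrite -(ler_pM2l subp_gt0).
have := ler_wpM2l p_ge0 (ltW lt); have := H2 b; lra.
Qed.

Lemma greedy_no_triangle g u v w : valid greedy g ->
  ~~ [&& joined red g u v, joined red g v w & joined red g u w].
Proof.
elim: g u v w => [|[[x y] c] g IH] u v w //= /and4P[xy nxy /eqP-> vg].
rewrite !joined_cons; have := IH u v w vg.
case gE: (greedy g x y) => //=; move: gE => /andP[nb _].
have nb' z : ~~ (joined red g x z && joined red g y z).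
  by apply: contra nb => H; apply/existsP; exists z; rewrite !(joinedC _ _ z).
have nx : ~~ joined red g x y by move: nxy; rewrite negb_or => /andP[].
(* A triangle using the new edge twice would have a loop as its third side. *)
have nl z : ~~ joined red g z z.
  elim: (g) vg => [//|[[x' y'] c'] g' IH'] /= /and4P[xy' _ _ /IH'].
  rewrite joined_cons negb_or => ->; rewrite andbT !xpair_eqE [X in _ || X]andbC orbb.
  by apply: contra xy' => /and3P[_ /eqP <-].
have J := joinedC red g.
rewrite !xpair_eqE => H; apply/negP => /and3P[].
have c1 := nb' u; have c2 := nb' v; have c3 := nb' w.
have l1 := nl u; have l2 := nl v; have l3 := nl w.
move=> /orP[/orP[]/andP[/eqP e1 /eqP e2]|j1] /orP[/orP[]/andP[/eqP e3 /eqP e4]|j2]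
  /orP[/orP[]/andP[/eqP e5 /eqP e6]|j3]; subst; move: H c1 c2 c3 l1 l2 l3 xy;
  rewrite ?eqxx ?(negPf xy) ?j1 ?j2 ?j3 //.
- by rewrite (J x u) (J y u) j1 j3.
- by rewrite (J x u) (J y u) j1 j3.
- by rewrite (J y v) j2.
- by rewrite (J x v) j2.
Qed.

Lemma sum3_lt1 (x y z : R) : 0 <= x -> 0 <= y -> 0 <= z ->
  x + y + z < 1 -> [/\ x < 1, y < 1 & z < 1].
Proof. by move=> x0 y0 z0 xyz; split; lra. Qed.

Lemma greedy_bounds g : valid greedy g ->
  [/\ forall w, (#|red_nbr g w| < D)%N,
      forall W S, #|W| = n -> #|S| = n ->
        (\sum_(w in W) #|red_nbr g w :&: S| < T)%N &
      forall S, #|S| = n -> no_red S g -> (free_count S g < m)%N].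
Proof.
move/valid_potential; rewrite /potential.
have h2 k : (0 : R) <= 2 ^- k by rewrite invr_ge0 exprn_ge0.
have hp : 0 <= (1 - p) ^+ m by rewrite exprn_ge0 // (ltW subp_gt0).
have pow2 (X : {set V * V}) k : 2 ^- k * red_weight X g < 1 ->
    (#|[set e in X | joined red g e.1 e.2]| < k)%N.
  rewrite mulrC ltr_pdivrMr ?exprn_gt0 // mul1r => /(le_lt_trans (red_weight_lb _ _)).
  by rewrite ltr_eXn2l // ltr1n.
have cardE W S : #|[set e in setX W S | joined red g e.1 e.2]| =
    (\sum_(w in W) #|red_nbr g w :&: S|)%N.
  under [RHS]eq_bigr do rewrite -sum1_card.
  rewrite pair_big_dep -sum1_card; apply: eq_bigl => -[x y].
  by rewrite !inE /= -andbA; congr andb; exact: andbC.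
case/sum3_lt1.
- by apply: sumr_ge0 => w _; rewrite mulr_ge0 ?red_weight_ge0.
- by apply: sumr_ge0 => w _; rewrite mulr_ge0 ?red_weight_ge0.
- by apply: sumr_ge0 => w _; rewrite mulr_ge0 ?blue_weight_ge0.
move=> HD HT Hm; split.
- move=> w; have := cardE [set w] setT; rewrite big_set1 setIT => <-; apply: pow2.
  apply: le_lt_trans HD; rewrite (bigD1 w) //= lerDl.
  by apply: sumr_ge0 => x _; rewrite mulr_ge0 ?red_weight_ge0.
- move=> W S Wn Sn; rewrite -cardE; apply: pow2.
  apply: le_lt_trans HT; rewrite (bigD1 (W, S)) ?Wn ?Sn ?eqxx //= lerDl.
  by apply: sumr_ge0 => x _; rewrite mulr_ge0 ?red_weight_ge0.
move=> S Sn nrS.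
have : (1 - p) ^+ m * blue_weight S g < 1.
  apply: le_lt_trans Hm; rewrite (bigD1 S) ?Sn //= lerDl.
  by apply: sumr_ge0 => w _; rewrite mulr_ge0 ?blue_weight_ge0.
rewrite blue_weightE // ltr_pdivrMr ?exprn_gt0 ?subp_gt0 // mul1r.
by rewrite ltr_iXn2l ?subp_gt0 // gtrBl.
Qed.

(** Initially every pair weighs [1 + 3 * p] and every blue weight is 1; the number of n-sets is
    bounded by [#|V| ^ n]. *)
Lemma potential_nil_le : potential [::] <=
  #|V|%:R * (1 + 3 * p) ^+ #|V| / 2 ^+ D
  + (#|V| ^ n)%:R ^+ 2 * (1 + 3 * p) ^+ (n * n) / 2 ^+ T
  + (#|V| ^ n)%:R * (1 - p) ^+ m.
Proof.
have h2 k : (0 : R) <= 2 ^- k by rewrite invr_ge0 exprn_ge0.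
have bin_le : ('C(#|V|, n) <= #|V| ^ n)%N.
  apply: (@leq_trans (#|V| ^_ n)); first by rewrite -bin_ffact leq_pmulr ?fact_gt0.
  by elim: n => [//|k IH]; rewrite ffactnSr expnSr leq_mul ?leq_subr.
rewrite /potential /=; apply: lerD; first apply: lerD.
- under eq_bigr do rewrite red_weight_nil cardsX cards1 cardsT mul1n.
  by rewrite sumr_const -[_ *+ #|V|]mulr_natl mulrA mulrAC.
- under eq_bigr => x /andP[/eqP x1 /eqP x2] do rewrite red_weight_nil cardsX x1 x2.
  rewrite sumr_const -[leLHS]mulr_natl mulrA mulrAC.
  do 2![apply: ler_wpM2r; rewrite ?h2 // ?exprn_ge0 //].
    by have := p_ge0; lra.
  rewrite -natrX ler_nat.
  have -> : #|[pred x : {set V} * {set V} | (#|x.1| == n) && (#|x.2| == n)]| =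
     ('C(#|V|, n) ^ 2)%N.
    rewrite -!card_draws -mulnn -cardsX; apply: eq_card => -[a b].
    by rewrite in_setX !inE.
  by rewrite leq_exp2r.
- rewrite sumr_const mulr1 -[leLHS]mulr_natl ler_wpM2r ?exprn_ge0 ?(ltW subp_gt0) //.
  by rewrite ler_nat (leq_trans _ bin_le) // -card_draws; apply/eq_leq/eq_card => A; rewrite !inE.
Qed.

End Greedy.

End Potential.

(** The threshold [T] becomes [n * t], an average of [t] red neighbors per vertex of an n-set. Fewer
    than [m] edges are free, and [sum_sqr_le] bounds the blocked ones. *)
Lemma painter_strategy (R : realFieldType) (V : finType) (p : R) (n m D t : nat) :
  0 < p < 1 ->
  #|V|%:R * (1 + 3 * p) ^+ #|V| / 2 ^+ D
  + (#|V| ^ n)%:R ^+ 2 * (1 + 3 * p) ^+ (n * n) / 2 ^+ (n * t)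
  + (#|V| ^ n)%:R * (1 - p) ^+ m < 1 ->
  exists Q : seq (V * V * color) -> V -> V -> color,
    winning n (m + D * (n * t) + #|V| * t ^ 2) Q.
Proof.
move=> /andP[p0 p1] /(le_lt_trans (potential_nil_le V p0 p1 n m D (n * t))) pot.
exists (greedy p n m D (n * t)) => g vg; split.
  by move=> u v w; exact: greedy_no_triangle vg.
move=> S Sn nrS; have [HD HT Hm] := greedy_bounds p0 p1 pot vg.
apply: (leq_ltn_trans (count_inside_le S vg)).
rewrite -addnA -addSn leq_add ?Hm //.
apply: sum_sqr_le => [||W Wn]; first by rewrite -Sn max_card.
  by move=> w; apply: leq_trans (ltnW (HD w)); rewrite subset_leq_card ?subsetIl.
exact: HT.
Qed.

(** * Reduction of the online game to its live edges *)

Section Reduction.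
Local Open Scope nat_scope.
Variables (M d : nat).
Implicit Types (h : history) (u v w : vertex) (s : seq vertex).

Definition degree h v := count (fun x => (x.1.1 == v) || (x.1.2 == v)) h.

Definition active h v := d <= degree h v.

(* The active vertices in order of activation; new ones are appended, so that
   ranks do not change later. *)
Fixpoint activated h : seq vertex :=
  if h is x :: h' then
    activated h' ++
      [seq w <- [:: x.1.1; x.1.2] | active h w && (w \notin activated h')]
  else [::].

(** Activity is tested before the edge is added, so an edge that activates one of its ends is not
    live. *)
Fixpoint live h : history :=
  if h is x :: h' then
    if active h' x.1.1 && active h' x.1.2 then x :: live h' else live h'
  else [::].

(** Meaningful only for active vertices, and while there are at most [M.+1] of them; otherwise
    [index] or [inord] may give a default value. *)
Definition rank h v : 'I_M.+1 := inord (index v (activated h)).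

Definition ranked h x : 'I_M.+1 * 'I_M.+1 * color :=
  (rank h x.1.1, rank h x.1.2, x.2).

Definition live_game h := [seq ranked h x | x <- live h].

Definition painter_of (Q : seq ('I_M.+1 * 'I_M.+1 * color) -> 'I_M.+1 -> 'I_M.+1 -> color) : painter :=
  fun h e =>
    if active h e.1 && active h e.2
    then Q (live_game h) (rank h e.1) (rank h e.2) else blue.

Fixpoint playable (P : painter) h : bool :=
  if h is x :: h' then [&& legal h' x.1, x.2 == P h' x.1 & playable P h']
  else true.

Lemma playable_play (B : builder) P t :
  (forall h, legal h (B h)) -> playable P (play B P t).
Proof. by move=> legB; elim: t => //= t ->; rewrite legB eqxx. Qed.

Lemma size_play (B : builder) P t : size (play B P t) = t.
Proof. by elim: t => //= t ->. Qed.

Lemma colored_edgeC c h u v : colored_edge c h u v = colored_edge c h v u.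
Proof. by rewrite /colored_edge orbC. Qed.

Lemma playable_neq P h x : playable P h -> x \in h -> x.1.1 != x.1.2.
Proof.
elim: h => //= y h IH /and3P[/andP[ne _] _ /IH]; rewrite inE => Hh.
by case/orP=> [/eqP->|].
Qed.

Lemma playable_color P h u v : playable P h ->
  colored_edge red h u v -> ~~ colored_edge blue h u v.
Proof.
elim: h => //= -[[a b] c] h IH /and3P[/andP[_ /= nadj] _ /IH {}IH].
have sym c' x y : colored_edge c' ((x, y, c) :: h) u v =
    (c' == c) && (((u, v) == (x, y)) || ((u, v) == (y, x))) || colored_edge c' h u v.
  rewrite /colored_edge !inE !xpair_eqE [(v == x) && (u == y)]andbC.
  by case: (c' == c); rewrite ?andbT ?andbF //= orbACA.
rewrite !sym.
have [e|ne] := boolP (((u, v) == (a, b)) || ((u, v) == (b, a))); last by rewrite !andbF.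
have : ~~ adjacent h u v.
  by case/orP: e => /eqP[-> ->] //; rewrite /adjacent !(colored_edgeC _ _ b a).
by rewrite /adjacent negb_or => /andP[/negPf -> /negPf ->]; case: c {sym nadj}.
Qed.

Lemma activated_cons h x : activated (x :: h) = activated h ++
  [seq w <- [:: x.1.1; x.1.2] | active (x :: h) w && (w \notin activated h)].
Proof. by []. Qed.

Lemma activeS h x v : active h v -> active (x :: h) v.
Proof. by move/leq_trans; apply; rewrite leq_addl. Qed.

Hypothesis d_gt0 : 0 < d.

Lemma mem_activated h v : (v \in activated h) = active h v.
Proof.
elim: h => [|x h IH]; first by rewrite /active leqNgt d_gt0.
rewrite activated_cons mem_cat mem_filter IH !inE.
have [av|nav] /= := boolP (active h v); first by rewrite activeS.
rewrite andbT; case: (boolP (active _ v)) => //= a.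
by apply: contraR nav; rewrite negb_or ![v == _]eq_sym => /andP[/negPf n1 /negPf n2];
   move: a; rewrite /active /= n1 n2.
Qed.

Lemma activated_uniq P h : playable P h -> uniq (activated h).
Proof.
elim: h => // x h IH /and3P[/andP[ne _] _ /IH uh].
rewrite activated_cons cat_uniq uh filter_uniq ?andbT; last by rewrite /= inE ne.
by apply/hasPn => w; rewrite mem_filter => /andP[/andP[]].
Qed.

Lemma sum_degree h s : uniq s -> \sum_(v <- s) degree h v <= 2 * size h.
Proof.
move=> us; elim: h => [|x h IH]; first by rewrite big1.
rewrite /= big_split /= mulnS leq_add //.
apply: (@leq_trans (\sum_(v <- s) ((x.1.1 == v) + (x.1.2 == v)))).
  by apply: leq_sum => v _; case: (x.1.1 == v); case: (x.1.2 == v).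
have le1 a : \sum_(v <- s) (a == v) <= 1.
  rewrite (eq_bigr (fun v => if v == a then 1 else 0)) => [|v _]; last by rewrite eq_sym; case: eqP.
  by rewrite -big_mkcond sum1_count (count_uniq_mem a us) leq_b1.
by rewrite big_split (leq_add (le1 _) (le1 _)).
Qed.

(** Double counting: every activated vertex has degree at least [d]. *)
Lemma size_activated P h : playable P h -> size (activated h) * d <= 2 * size h.
Proof.
move=> /activated_uniq/(sum_degree h); apply: leq_trans.
rewrite -[leqLHS]mulnC -iter_addn_0 -(count_predT (activated h)) -big_const_seq big_seq [X in _ <= X]big_seq; apply: leq_sum => v.
by rewrite mem_activated.
Qed.

Lemma live_sub h : {subset live h <= h}.
Proof.
elim: h => //= x h IH y; rewrite [y \in _ :: h]inE.
by case: ifP => _; first rewrite inE => /orP[->//|]; move/IH ->; rewrite orbT.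
Qed.

Lemma live_activated h x : x \in live h -> active h x.1.1 && active h x.1.2.
Proof.
elim: h => //= y h IH.
have aS : active h x.1.1 && active h x.1.2 ->
    active (y :: h) x.1.1 && active (y :: h) x.1.2.
  by move=> /andP[a1 a2]; rewrite !activeS.
case: ifP => [ay|_]; last by move/IH.
by rewrite inE => /orP[/eqP xy|/IH //]; apply: aS; rewrite xy.
Qed.

Lemma rank_cons h x v : active h v -> rank (x :: h) v = rank h v.
Proof. by move=> av; rewrite /rank /= index_cat mem_activated av. Qed.

Lemma live_game_cons h x : live_game (x :: h) =
  if active h x.1.1 && active h x.1.2 then ranked h x :: live_game h
  else live_game h.
Proof.
have E : [seq ranked (x :: h) y | y <- live h] = live_game h.
  by apply/eq_in_map => y /live_activated/andP[a1 a2]; rewrite /ranked !rank_cons.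
rewrite {1}/live_game /=; case: ifP => [/andP[a1 a2]|_]; rewrite ?map_cons E //.
by rewrite /ranked !rank_cons.
Qed.

Section Play.
Variables (P : painter) (h : history).
Hypothesis (playh : playable P h) (short : 2 * size h < d * M.+2).

(** By [short] at most [M.+1] vertices are activated, so [inord] cuts off no index. *)
Lemma rank_inj u v : active h u -> active h v -> rank h u = rank h v -> u = v.
Proof.
rewrite -!mem_activated => au av /(congr1 val).
have szM : size (activated h) <= M.+1.
  rewrite -ltnS -(ltn_pmul2r d_gt0) [M.+2 * d]mulnC.
  exact: leq_ltn_trans (size_activated playh) short.
rewrite /= !inordK ?(leq_trans _ szM) ?index_mem // => e.
by rewrite -(nth_index 0 au) e nth_index.
Qed.

Lemma live_game_joined c u v : active h u -> active h v ->
  joined c (live_game h) (rank h u) (rank h v) -> colored_edge c h u v.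
Proof.
have H a b : active h a -> active h b ->
    (rank h a, rank h b, c) \in live_game h -> (a, b, c) \in h.
  move=> aa ab /mapP[[[a' b'] c'] lx [ra rb cc]].
  have /andP[a1 a2] := live_activated lx; move: (live_sub lx).
  by rewrite cc (rank_inj aa a1 ra) (rank_inj ab a2 rb).
by move=> au av /orP[] e; rewrite /colored_edge (H _ _ _ _ e) ?orbT.
Qed.

End Play.

(** Ranks are injective on active vertices, so a loop or a repeated edge among ranks would come from
    one in the original game. *)
Lemma live_game_valid Q h : playable (painter_of Q) h ->
  2 * size h < d * M.+2 -> valid Q (live_game h).
Proof.
elim: h => // x h IH /= /and3P[/andP[ne nadj] /eqP xc playh] short.
have short' : 2 * size h < d * M.+2 by apply: leq_ltn_trans short; rewrite mulnS leq_addl.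
rewrite live_game_cons; case: ifP => [/andP[a1 a2]|_]; last exact: IH.
rewrite /= IH // andbT; apply/and3P; split.
- by apply: contra ne => /eqP /(rank_inj playh short' a1 a2) ->.
- by apply: contra nadj => /orP[] /(live_game_joined playh short' a1 a2) e;
     rewrite /adjacent e ?orbT.
- by rewrite xc /painter_of a1 a2.
Qed.

(** Edges that are not live are always painted blue. *)
Lemma red_joined Q h u v : playable (painter_of Q) h ->
  colored_edge red h u v -> joined red (live_game h) (rank h u) (rank h v).
Proof.
have H a b : playable (painter_of Q) h -> (a, b, red) \in h -> (a, b, red) \in live h.
  elim: h => //= x h IH /and3P[_ /eqP xc /IH {}IH].
  rewrite inE => /orP[/eqP xE|/IH]; last by case: ifP => // _; rewrite inE orbC => ->.
  by move: xc; rewrite -xE /painter_of /=; case: ifP => // _ _; rewrite inE eqxx.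
by move=> playh /orP[] /(H _ _ playh) /(map_f (ranked h)) e;
   rewrite /joined e ?orbT.
Qed.

(** * Counting the live edges of a clique *)

Definition within s (x : vertex * vertex * color) := (x.1.1 \in s) && (x.1.2 \in s).

(** An edge inside [s] that is not live has an end that was inactive before it. It raises the degree
    of this end, capped at [d], and is charged to it. *)
Lemma count_within_live h s : uniq s ->
  count (within s) h <= count (within s) (live h) + \sum_(v <- s) minn d (degree h v).
Proof.
move=> us; elim: h => [//|x h IH].
have mono v : minn d (degree h v) <= minn d (degree (x :: h) v).
  by rewrite /= ; lia.
have sum_mono : \sum_(v <- s) minn d (degree h v) <= \sum_(v <- s) minn d (degree (x :: h) v).
  by apply: leq_sum => v _.
rewrite [live _]/= [count _ (x :: h)]/=; case: ifP => [_|na].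
  by rewrite [count _ (x :: _)]/= -addnA leq_add2l (leq_trans IH) // leq_add2l.
have [/andP[us1 vs]|_] := boolP (within s x); last by rewrite (leq_trans IH) // leq_add2l.
have strict w : w \in s -> (x.1.1 == w) || (x.1.2 == w) -> ~~ active h w ->
    (\sum_(v <- s) minn d (degree h v)).+1 <= \sum_(v <- s) minn d (degree (x :: h) v).
  move=> ws xw naw; rewrite !(big_rem w ws) /= -addSn leq_add //; last exact: leq_sum.
  by move: naw; rewrite xw /active; lia.
suff : (\sum_(v <- s) minn d (degree h v)).+1 <= \sum_(v <- s) minn d (degree (x :: h) v).
  by move: IH; lia.
move/negbT: na; rewrite negb_and => /orP[].
  by apply: strict us1 _; rewrite eqxx.
by apply: strict vs _; rewrite eqxx orbT.
Qed.

Lemma clique_degree c h s v : uniq s -> v \in s ->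
  {in s &, forall u v, u != v -> colored_edge c h u v} ->
  (size s).-1 <= degree h v.
Proof.
move=> us vs clq; rewrite -(size_rem vs) /degree -size_filter.
pose other (x : vertex * vertex * color) := if x.1.1 == v then x.1.2 else x.1.1.
rewrite -(size_map other); apply: uniq_leq_size; first exact: rem_uniq.
move=> u; rewrite mem_rem_uniq // inE => /andP[uv us'].
apply/mapP; case/orP: (clq u v us' vs uv) => e.
  by exists (u, v, c); rewrite ?mem_filter /other /= ?(negPf uv) // eqxx e.
by exists (v, u, c); rewrite ?mem_filter /other /= eqxx // e.
Qed.

(** The square s x s is covered by the edges inside [s], read in both directions, and the
    diagonal. *)
Lemma clique_count c h s : uniq s ->
  {in s &, forall u v, u != v -> colored_edge c h u v} ->
  size s * size s <= 2 * count (within s) h + size s.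
Proof.
move=> us clq; rewrite -size_filter mulSn mul1n.
set f := filter _ h.
rewrite -[X in X + X + _](size_map fst) -{2}(size_map (fun x : vertex * vertex => (x.2, x.1)) (map fst f)).
rewrite -[X in _ <= _ + X](size_map (fun u => (u, u))) -!size_cat -(size_allpairs pair).
apply: uniq_leq_size; first by apply: allpairs_uniq => // -[a b] [a' b'] _ _.
move=> [u v] /allpairsP[[a b] /= [sa sb [-> ->]]]; rewrite !mem_cat.
have [->|ab] := eqVneq a b; first by rewrite (map_f (fun u => (u, u)) sb) orbT.
have fin c' x y : x \in s -> y \in s -> (x, y, c') \in h -> (x, y) \in map fst f.
  by move=> xs ys xy; apply: (map_f fst (x := (x, y, c'))); rewrite mem_filter /within xs ys.
case/orP: (clq a b sa sb ab) => e; first by rewrite (fin c a b).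
by rewrite (map_f (fun x : vertex * vertex => (x.2, x.1)) (fin c b a sb sa e)) orbT.
Qed.

(** In a shorter game the active vertices have distinct ranks. A red triangle would consist of live
    edges, against [Q]. A blue K_n has at least n(n-1)/2 edges, of which at most nd are not live,
    leaving at least [K]. *)
Lemma builder_wins_lower_bound (n K N : nat)
    (Q : seq ('I_M.+1 * 'I_M.+1 * color) -> 'I_M.+1 -> 'I_M.+1 -> color) :
  winning n K Q ->
  d < n -> n + 2 * K + 2 * (n * d) <= n * n ->
  builder_wins 3 n N -> d * M.+2 <= 2 * N.
Proof.
move=> HQ dn nK [B [legB /(_ (painter_of Q))]].
have playh := playable_play (painter_of Q) N legB.
rewrite leqNgt => Hwin; apply/negP => short; move: Hwin.
rewrite -[N in X in X < _](size_play B (painter_of Q) N) in short.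
set h := play _ _ _ in short playh *.
have [tri ind] := HQ _ (live_game_valid playh short).
case=> -[s [us sz clq]].
  case: s us sz clq => [|a [|b [|c []]]] //= us _ clq.
  move: us; rewrite !inE !negb_or -!andbA => /and4P[ab ac bc _].
  have := tri (rank h a) (rank h b) (rank h c).
  by rewrite !(red_joined playh) // clq ?inE ?eqxx ?orbT.
have act v : v \in s -> active h v.
  by move=> vs; apply: leq_trans (clique_degree us vs clq); rewrite sz; lia.
pose S := [set x in [seq rank h v | v <- s]].
have Sn : #|S| = n.
  rewrite cardsE (card_uniqP _) ?size_map // map_inj_in_uniq // => u v su sv.
  by apply: (rank_inj playh short); apply: act.
have nrS : no_red S (live_game h).
  move=> x y; rewrite !inE => /mapP[u us' ->] /mapP[v vs ->]; apply/negP.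
  move=> /(live_game_joined playh short (act _ us') (act _ vs)) e.
  have uv : u != v.
    by case/orP: e => /(playable_neq playh) //=; rewrite eq_sym.
  by have := playable_color playh e; rewrite clq.
have := ind S Sn nrS.
have : count (within s) (live h) <= count (inside S) (live_game h).
  rewrite count_map; apply: sub_count => x /andP[x1 x2].
  by rewrite /inside /= !inE !map_f.
have := count_within_live h us.
have : \sum_(v <- s) minn d (degree h v) <= n * d.
  rewrite -sz mulnC -iter_addn_0 -(count_predT s) -big_const_seq; apply: leq_sum => v _; exact: geq_minl.
have := clique_count us clq; rewrite sz; lia.
Qed.

End Reduction.

(** * Choice of the parameters *)

From mathcomp Require Import all_classical all_reals all_analysis.
Import numFieldNormedType.Exports.

Section Exponentials.
Variable R : realType.
Implicit Types (x : R) (k n : nat).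

Lemma expr1D_le x k : 0 <= 1 + x -> (1 + x) ^+ k <= expR (x * k%:R).
Proof.
by move=> x0; rewrite expRM_natr lerXn2r ?nnegrE ?expR_ge0 ?expR_ge1Dx.
Qed.

Lemma pow2_le_expR k : 2 ^+ k <= expR k%:R :> R.
Proof. by have := @expr1D_le 1 k; rewrite mul1r; apply. Qed.

Lemma pow2V_le_expR k : 2 ^- k <= expR (- (k%:R / 2)) :> R.
Proof.
rewrite -exprVn (_ : 2^-1 = 1 + - 2^-1); last by field.
apply: (le_trans (expr1D_le _ _)); first by lra.
by rewrite ler_expR; lra.
Qed.

Lemma expR_le_quarter x : x <= - 2 -> expR x <= 4^-1.
Proof.
move=> x2; apply: (@le_trans _ _ (expR (- 2))); first by rewrite ler_expR.
rewrite expRN lef_pV2 ?posrE ?expR_gt0 //.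
by apply: le_trans (pow2_le_expR 2); rewrite -natrX ler_nat.
Qed.

End Exponentials.

(* With n <= 2 ^ L <= exp L, the union bound over pairs of n-sets and the factor
   (1 + 3p) ^ n^2 cost at most exp (4nL) and exp (192nL); 2 ^ - (394nL) is at most
   exp (- 197nL).  The constant 64 makes the last term at most exp (2nL - 4nL). *)
Lemma potential_bound (R : realType) (n L v D m : nat) (p : R) :
  (0 < n)%N -> (0 < L)%N -> (2 <= n * L)%N -> (n <= 2 ^ L)%N -> (v <= n ^ 2)%N ->
  0 < p < 1 -> p * n%:R = 64 * L%:R ->
  2 * L%:R + 3 * p * v%:R + 2 <= D%:R / 2 ->
  (n * n)%:R / 16 <= m%:R :> R ->
  v%:R * (1 + 3 * p) ^+ v / 2 ^+ D
  + (v ^ n)%:R ^+ 2 * (1 + 3 * p) ^+ (n * n) / 2 ^+ (n * (394 * L))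
  + (v ^ n)%:R * (1 - p) ^+ m < 1.
Proof.
move=> n0 L0 nL nexp vn /andP[p0 p1] pn HD Hm.
have vexp : v%:R <= expR (2 * L%:R) :> R.
  rewrite mulrC expRM_natr; apply: (@le_trans _ _ (n%:R ^+ 2)); first by rewrite -natrX ler_nat.
  rewrite lerXn2r ?nnegrE ?expR_ge0 ?ler0n //; apply: le_trans (pow2_le_expR _ _).
  by rewrite -natrX ler_nat.
have vnexp : (v ^ n)%:R <= expR (2 * L%:R * n%:R) :> R.
  by rewrite natrX expRM_natr lerXn2r ?nnegrE ?expR_ge0.
have base0 : 0 <= 1 + 3 * p by lra.
have h2 k : (0 : R) <= 2 ^- k by rewrite invr_ge0 exprn_ge0.
have nL1 : (2 : R) <= n%:R * L%:R by rewrite -natrM ler_nat.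
(* Each of the three terms is at most exp(-2), hence at most 1/4. *)
have t1 : v%:R * (1 + 3 * p) ^+ v / 2 ^+ D <= 4^-1.
  apply: le_trans (expR_le_quarter (x := 2 * L%:R + 3 * p * v%:R - D%:R / 2) _); last by lra.
  rewrite !expRD ler_pM ?mulr_ge0 ?exprn_ge0 ?ler0n ?pow2V_le_expR //.
  by rewrite ler_pM ?exprn_ge0 ?ler0n // expr1D_le.
have t2 : (v ^ n)%:R ^+ 2 * (1 + 3 * p) ^+ (n * n) / 2 ^+ (n * (394 * L)) <= 4^-1.
  apply: le_trans (expR_le_quarter (x := 2 * L%:R * n%:R * 2 + 3 * p * (n * n)%:R
     - (n * (394 * L))%:R / 2) _); last first.
    by rewrite !natrM -[3 * p * _]mulrA (mulrA p) pn; lra.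
  rewrite !expRD ler_pM ?mulr_ge0 ?exprn_ge0 ?ler0n ?pow2V_le_expR //.
  rewrite ler_pM ?exprn_ge0 ?ler0n ?expr1D_le //.
  by rewrite expRM_natr lerXn2r ?nnegrE ?expR_ge0 ?ler0n.
have t3 : (v ^ n)%:R * (1 - p) ^+ m <= 4^-1.
  apply: le_trans (expR_le_quarter (x := 2 * L%:R * n%:R - p * m%:R) _); last first.
    have := ler_wpM2l (ltW p0) Hm; rewrite natrM !mulrA pn; lra.
  rewrite expRD ler_pM ?exprn_ge0 ?ler0n //; first by lra.
  by rewrite -mulNr expr1D_le //; lra.
by lra.
Qed.

Lemma builder_wins_bound (R : realType) (n L M N : nat) :
  (0 < L)%N -> (n <= 2 ^ L)%N -> (2 ^ 16 * (L * (2 * L + 3)) <= n)%N ->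
  (2 ^ 23 * L ^ 2 * M.+1 <= n ^ 2)%N ->
  builder_wins 3 n N -> (n %/ 4 * M.+2 <= 2 * N)%N.
Proof.
move=> L0 nexp nL nM.
have n0 : (0 < n)%N by lia.
pose p : R := 64 * L%:R / n%:R.
(* Small enough that [D * (n * (394 * L))] is below n^2/20, and large enough that D/2 dominates 3p
   times the number of vertices, which is at most 3n/(2^17 L). *)
pose D := (n %/ (2 ^ 13 * L))%N.
pose m := (n * n %/ 16).+1.
have nR : (0 : R) < n%:R by rewrite ltr0n.
have LR : (0 : R) < L%:R by rewrite ltr0n.
have pn : p * n%:R = 64 * L%:R by rewrite /p divfK // gt_eqF.
have p01 : 0 < p < 1.
  by rewrite divr_gt0 ?mulr_gt0 //= ltr_pdivrMr // mul1r -natrM ltr_nat; nia.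
have [|Q HQ] := @painter_strategy R 'I_M.+1 p n m D (394 * L) p01.
  rewrite card_ord; apply: (@potential_bound R n L) => //.
  - by nia.
  - by nia.
  (* In terms of X = n/L, the condition on [D] follows from linear inequalities. *)
  - pose X : R := n%:R / L%:R.
    have nX : n%:R = X * L%:R by rewrite /X divfK // gt_eqF.
    have X0 : 0 < X by rewrite divr_gt0.
    have X_ge : 2 ^+ 16 * (2 * L%:R + 3) <= X.
      move: nL; clear nM; rewrite -(ler_nat R) nX natrM natrX natrM natrD natrM => H.
      by rewrite -(ler_pM2r LR); lra.
    have MX : 2 ^+ 23 * M.+1%:R <= X ^+ 2.
      move: nM; clear nL X_ge; rewrite -(ler_nat R) (natrM _ _ M.+1) natrM !natrX nX => H.
      by rewrite -(ler_pM2r (exprn_gt0 2 LR)) -exprMn; lra.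
    have DX : X <= (D%:R + 1) * 2 ^+ 13.
      rewrite -(ler_pM2r LR) -nX natr1 -mulrA -natrX -!natrM ler_nat ltnW //.
      by rewrite ltn_ceil //; nia.
    have pM : p * M.+1%:R <= 64 / 2 ^+ 23 * X.
      have -> : p = 64 / X by rewrite /p nX invfM mulrA mulrAC mulfK // gt_eqF.
      by rewrite mulrAC ler_pdivrMr //; clear nL nM; lra.
    rewrite -(mulrA 3); clear nL nM.
    by move: X_ge DX pM; move: (p * _) => y; lra.
  - by rewrite ler_pdivrMr // -natrM ler_nat /m ltnW // ltn_ceil.
apply: (builder_wins_lower_bound _ HQ).
- by rewrite divn_gt0 //; nia.
- by rewrite ltn_divLR //; lia.
(* The budget of n^2: edges that are not live take n^2/2, free edges n^2/8 + 2, the two terms for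
   blocked edges n^2/10 and n^2/25, and the diagonal n^2/100. *)
have Dn : (2 ^ 13 * (D * L * n) <= n * n)%N.
  by rewrite mulnA leq_mul2r; apply/orP; right; have := leq_divM n (2 ^ 13 * L); rewrite -/D; lia.
have mn : (16 * m <= n * n + 16)%N.
  by have := leq_divM (n * n) 16; rewrite /m; lia.
have qn : (4 * (n * (n %/ 4)) <= n * n)%N.
  by have := leq_divM n 4; nia.
have nn : (100 * n <= n * n)%N by rewrite leq_mul2r; lia.
have -> : (D * (n * (394 * L)) = 394 * (D * L * n))%N by lia.
rewrite card_ord expnMn; move: nM; rewrite -mulnA -[(n ^ 2)%N]mulnn.
move: (D * L * n)%N Dn => a Dn; rewrite -mulnA.
have -> : (M.+1 * (394 ^ 2 * L ^ 2) = 394 ^ 2 * (L ^ 2 * M.+1))%N by lia.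
move: (L ^ 2 * M.+1)%N (n * (n %/ 4))%N qn (n * n)%N nn Dn mn => b c; lia.
Qed.

(** * The asymptotic estimate *)

Lemma builder_wins_online_ramsey (m n : nat) :
  builder_wins m n (online_ramsey m n).
Proof. by rewrite /online_ramsey; case: ex_minnP => N /asboolP. Qed.

Lemma sqr_le_pow2 (k : nat) : (32 <= k)%N ->
  (2 ^ 16 * (k.+1 * (2 * k.+1 + 3)) <= 2 ^ k)%N.
Proof.
move=> k32; have -> : (2 ^ k = 2 ^ 16 * 2 ^ (k - 16))%N by rewrite -expnD subnKC //; lia.
rewrite leq_mul2l; apply/orP; right.
elim: k k32 => // k IH; rewrite leq_eqVlt => /orP[/eqP <- //|k32].
have := IH k32; rewrite subSn ?expnS; last by lia.
by move: (2 ^ (k - 16))%N => y; nia.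
Qed.

Lemma online_ramsey_lower_bound (R : realType) (n : nat) :
  (32 <= trunc_log 2 n)%N ->
  (n ^ 3 <= 2 ^ 27 * (trunc_log 2 n).+1 ^ 2 * online_ramsey 3 n)%N.
Proof.
set k := trunc_log 2 n; set L := k.+1 => k32.
have n0 : (0 < n)%N by move: k32; rewrite /k; case: (n) => //; rewrite trunc_log0.
have nL : (n <= 2 ^ L)%N by apply: ltnW; apply: trunc_log_ltn.
have Ln : (2 ^ 16 * (L * (2 * L + 3)) <= n)%N.
  by apply: leq_trans (sqr_le_pow2 k32) _; exact: trunc_logP.
have L0 : (0 < L)%N by [].
(* The largest number of vertices that [builder_wins_bound] allows; [M] is then [v.-1]. *)
pose v := (n ^ 2 %/ (2 ^ 23 * L ^ 2))%N.
have den0 : (0 < 2 ^ 23 * L ^ 2)%N by rewrite muln_gt0 !expn_gt0.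
have v0 : (0 < v)%N.
  rewrite divn_gt0 //; apply: (@leq_trans ((2 ^ 16 * (L * (2 * L + 3))) ^ 2)%N); last by rewrite leq_exp2r.
  rewrite (expnMn (2 ^ 16)%N); apply: leq_mul; first by rewrite -expnM leq_exp2l.
  by rewrite leq_exp2r // leq_pmulr // addnS.
have H : (n %/ 4 * v.+1 <= 2 * online_ramsey 3 n)%N.
  rewrite -(prednK v0).
  apply: (builder_wins_bound R L0 nL Ln _ (builder_wins_online_ramsey 3 n)).
  by rewrite (prednK v0) [leqLHS]mulnC leq_divM.
have n4 : (n <= 8 * (n %/ 4))%N.
  have := ltn_ceil n (isT : 0 < 4)%N.
  have : (8 <= n)%N by nia.
  by lia.
have nv := ltn_ceil (n ^ 2) den0.
(* Having [v.+1] instead of [v] absorbs the rounding in [v]. The factor 8, which covers the rounding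
   of n/4, and the 2 in [H] give 2^4. *)
apply: (@leq_trans (8 * (n %/ 4) * (v.+1 * (2 ^ 23 * L ^ 2)))%N).
  by rewrite expnS leq_mul // ltnW.
rewrite (_ : 27 = 23 + 4)%N // expnD; move: H; move: (2 ^ 23)%N (L ^ 2)%N => a b H.
by move: (leq_mul (leqnn (8 * a * b)) H)%N; lia.
Qed.

Local Open Scope classical_set_scope.

Theorem theorem4 (R : realType) :
  (fun n : nat => (online_ramsey 3 n)%:R : R) \is
    'Omega_\oo (fun n : nat => n%:R ^+ 3 / ln n%:R ^+ 2 : R).
Proof.
have [K HK] : exists K, forall n, (K <= n)%N -> (32 <= trunc_log 2 n)%N.
  by exists (2 ^ 32)%N => n; exact: trunc_log_max.
(* 2^31 is 2^27 times 4^2, the 4 coming from k + 1 <= 4 ln n. *)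
rewrite qualifE; apply/asboolP; exists (2 ^- 31); first by rewrite invr_gt0 exprn_gt0.
near=> n.
have k32 : (32 <= trunc_log 2 n)%N by apply: HK; near: n; exact: nbhs_infty_ge.
set k := trunc_log 2 n in k32.
have n0 : (0 < n)%N by move: k32; rewrite /k; case: (n) => //; rewrite trunc_log0.
have nR : (0 : R) < n%:R by rewrite ltr0n.
(* This follows from exp(1/2) <= 2 and 2^k <= n. *)
have kln : k%:R / 2 <= ln n%:R :> R.
  rewrite -ler_expR lnK ?posrE //; apply: (@le_trans _ _ (2 ^+ k)).
    by have := @pow2V_le_expR R k; rewrite expRN lef_pV2 // posrE ?exprn_gt0 ?expR_gt0.
  by rewrite -natrX ler_nat; exact: trunc_logP.
have kR : (32 : R) <= k%:R by rewrite ler_nat.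
have ln0 : 0 < ln (n%:R : R) by lra.
have kln2 : (k.+1%:R : R) ^+ 2 <= (4 * ln n%:R) ^+ 2.
  by rewrite lerXn2r ?nnegrE ?ler0n ?mulr_ge0 ?(ltW ln0) // -natr1; lra.
rewrite !ger0_norm ?ler0n //; last by rewrite divr_ge0 ?exprn_ge0 ?ltW.
rewrite ler_pdivrMl ?exprn_gt0 // ler_pdivrMr ?exprn_gt0 //.
have bound : n%:R ^+ 3 <= 2 ^+ 27 * k.+1%:R ^+ 2 * (online_ramsey 3 n)%:R :> R.
  by rewrite -!natrX -!natrM ler_nat; exact: online_ramsey_lower_bound R _ k32.
apply: le_trans bound _; rewrite [leRHS]mulrAC; apply: ler_wpM2r; first exact: ler0n.
by move: kln2; rewrite exprMn; lra.
Unshelve. all: by end_near.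
Qed.
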